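(* Let $G$ be a graph of VC-dimension at most $d$ and let $T$ be a set of vertices of $G$ of size at most $k$. Then there is a set of vertices $S\subseteq V(G)$ with $|S|\le k^{O(d^2)}$ and an $S$-definable flip $G'$ of $G$ such that $$\mathrm{Ball}^r_{G'}(v)\subseteq\mathrm{Ball}^{30r}_T(v)\qquad\text{for all } v\in V(G)\text{ and } r\in\mathbb{N}.$$
   Context: Graphs are finite, simple and undirected. $N_G(v)$ is the open neighborhood of $v$; $\mathrm{dist}_G$ is shortest-path distance ($\infty$ between different components); $\mathrm{Ball}^r_G(v)$ is the set of vertices at distance at most $r$ from $v$ in $G$. VC-dimension: $G$ shatters $A\subseteq V(G)$ if for each $B\subseteq A$ there is a vertex $u_B$ with $N_G(u_B)\cap A=B$. The VC-dimension of $G$ is the maximum size of a set shattered by $G$. Flips: for (not necessarily disjoint) $A,B\subseteq V(G)$, the $(A,B)$-flip of $G$ is the graph on $V(G)$ with edge set $E(G)\,\triangle\,\{ab : a\in A, b\in B, a\ne b\}$. For a partition $\mathcal{P}$ of $V(G)$, a $\mathcal{P}$-flip of $G$ is a graph obtained from $G$ by, for each pair of (possibly equal) parts $P,P'\in\mathcal{P}$, either complementing the adjacency relation between distinct vertices of $P$ and $P'$ or leaving it unchanged. Definable flips: for $S\subseteq V(G)$, $\mathcal{P}_S$ is the partition of $V(G)$ in which every $s\in S$ forms a singleton part, and two vertices $u,v\in V(G)\setminus S$ are in the same part iff $N_G(u)\cap S=N_G(v)\cap S$. An $S$-definable flip of $G$ is a $\mathcal{P}_S$-flip of $G$. Flip-metric: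 for $T\subseteq V(G)$, $\mathrm{dist}_T(u,v)=\max\{\mathrm{dist}_{H}(u,v) : H \text{ is a } T\text{-definable flip of } G\}$, and $\mathrm{Ball}^r_T(v)=\{u\in V(G):\mathrm{dist}_T(u,v)\le r\}$. The notation $k^{O(d^2)}$ stands for a bound of the form $k^{Cd^2}$ with an absolute constant $C$ (independent of $G,T,k,d$), read in the usual asymptotic sense, i.e. for $k\ge 2$. *)

(* Defs.v *)
From HB Require Import structures.
From mathcomp Require Import all_boot.

Set Implicit Arguments.
Unset Strict Implicit.
Unset Printing Implicit Defensive.

(* Distances live in nat extended with infinity: [None] is infinity. *)
Definition enat := option nat.

Definition lee (x y : enat) : bool :=
  match x, y with
  | _, None => true
  | None, Some _ => false
  | Some m, Some n => m <= n
  end.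

Definition maxe (x y : enat) : enat :=
  match x, y with
  | Some m, Some n => Some (maxn m n)
  | _, _ => None
  end.

Lemma maxeA : associative maxe.
Proof. by move=> [m|] [n|] [p|] //=; rewrite maxnA. Qed.

Lemma maxeC : commutative maxe.
Proof. by move=> [m|] [n|] //=; rewrite maxnC. Qed.

Lemma max0e : left_id (Some 0) maxe.
Proof. by move=> [m|] //=; rewrite max0n. Qed.

HB.instance Definition _ :=
  Monoid.isComLaw.Build enat (Some 0) maxe maxeA maxeC max0e.

Lemma lee_max x y z : lee (maxe x y) z = lee x z && lee y z.
Proof. by case: x y z => [m|] [n|] [p|] //=; rewrite ?geq_max ?andbF. Qed.

Section Graphs.
Variable V : finType.

(* A graph on [V] is a symmetric irreflexive [e : rel V]; the definitions below
   make sense for arbitrary relations. *)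
Implicit Types (e : rel V) (u v : V) (A B S T : {set V}) (P : {set {set V}}).

Definition nbhd e v : {set V} := [set w | e v w].

Definition walk e u v (n : nat) : bool :=
  [exists p : n.-tuple V, path e u p && (last u p == v)].

Lemma walkP e u v n :
  reflect (exists p, [/\ size p = n, path e u p & last u p = v]) (walk e u v n).
Proof.
apply: (iffP existsP) => [[p /andP[pth /eqP lst]]|[p [/eqP sz pth lst]]].
  by exists p; rewrite size_tuple.
by exists (Tuple sz); rewrite /= pth lst eqxx.
Qed.

Lemma connect_walk e u v : connect e u v -> exists n, walk e u v n.
Proof. by case/connectP=> p pth lst; exists (size p); apply/walkP; exists p. Qed.

Definition dist e u v : enat :=
  match boolP (connect e u v) with
  | AltTrue uv => Some (ex_minn (connect_walk uv))
  | AltFalse _ => None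
  end.

Lemma dist_leP e u v r :
  reflect (exists p, [/\ size p <= r, path e u p & last u p = v])
          (lee (dist e u v) (Some r)).
Proof.
rewrite /dist; destruct (boolP (connect e u v)) as [uv|nuv] => /=.
  case: ex_minnP => m wm minm.
  apply: (iffP idP) => [mr|[q [szq qth qlst]]].
    by have /walkP[p [szp pth lst]] := wm; exists p; rewrite szp.
  by apply: leq_trans szq; apply: minm; apply/walkP; exists q.
apply: ReflectF => -[p [_ pth lst]].
by case/connectP: nuv; exists p.
Qed.

Definition ball e (r : nat) v : {set V} := [set u | lee (dist e u v) (Some r)].

Definition shatters e A : bool :=
  [forall B : {set V}, (B \subset A) ==> [exists u, nbhd e u :&: A == B]].

Definition vcdim e : nat := \max_(A : {set V} | shatters e A) #|A|.

(* The P-flip of [e] in which exactly the pairs of parts in [F] are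
   complemented.  [F] is a set of unordered pairs, the pair of parts Q, Q' being
   encoded as [[set Q; Q']] (so [[set Q]] when Q = Q'); members of [F] that are
   not of this form have no effect. *)
Definition flip e P (F : {set {set {set V}}}) : rel V :=
  fun u v => (u != v) && (e u v (+) ([set pblock P u; pblock P v] \in F)).

Definition def_partition e S : {set {set V}} :=
  [set [set s] | s in S] :|: preim_partition (fun u => nbhd e u :&: S) (~: S).

Definition definable_flip e S (F : {set {set {set V}}}) : rel V :=
  flip e (def_partition e S) F.

Definition flip_dist e T u v : enat :=
  \big[maxe/Some 0]_(F : {set {set {set V}}}) dist (definable_flip e T F) u v.

Definition flip_ball e T (r : nat) v : {set V} :=
  [set u | lee (flip_dist e T u v) (Some r)].

Lemma flip_sym e P F : symmetric e -> symmetric (flip e P F).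
Proof. by move=> es u v; rewrite /flip eq_sym es setUC. Qed.

Lemma flip_irr e P F : irreflexive (flip e P F).
Proof. by move=> u; rewrite /flip eqxx. Qed.

Lemma def_partitionP e S : partition (def_partition e S) [set: V].
Proof.
set f := fun u => nbhd e u :&: S.
have pS : partition (preim_partition f (~: S)) (~: S) by apply: preim_partitionP.
have [/eqP cov triv n0] := and3P pS.
have sub B : B \in preim_partition f (~: S) -> B \subset ~: S.
  by move=> BP; rewrite -cov; apply: bigcup_sup BP.
apply/and3P; split.
- rewrite /cover bigcup_setU -/(cover (preim_partition f _)) cov.
  rewrite -/(cover [set [set s] | s in S]) cover_imset.
  apply/eqP/setP=> x; rewrite !inE; case: (boolP (x \in S)); rewrite ?orbT //.
  by move=> xS; rewrite orbF; apply/bigcupP; exists x; rewrite ?inE.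
- apply/trivIsetP=> A B; rewrite !in_setU.
  have dS s C : s \in S -> C \in preim_partition f (~: S) -> [disjoint [set s] & C].
    move=> sS CP; rewrite disjoints1; apply/negP=> sC.
    by have := subsetP (sub C CP) s sC; rewrite inE sS.
  case/orP=> [/imsetP[s sS ->]|AP] /orP[/imsetP[t tS ->]|BP] neq.
  + by rewrite disjoints1 inE; apply: contraNneq neq => ->.
  + exact: dS.
  + by rewrite disjoint_sym; apply: dS.
  + exact: (trivIsetP triv).
- rewrite in_setU negb_or n0 andbT; apply/imsetP=> -[s _ /setP/(_ s)].
  by rewrite !inE eqxx.
Qed.

Lemma flip_dist_leP e T u v r :
  reflect (forall F, lee (dist (definable_flip e T F) u v) (Some r))
          (lee (flip_dist e T u v) (Some r)).
Proof.
rewrite /flip_dist.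
rewrite (big_morph (fun x => lee x (Some r)) (id1 := true) (op1 := andb)) //.
  by rewrite big_andE; apply: forallP.
by move=> x y; rewrite lee_max.
Qed.

End Graphs.

(* Main.v *)
Require Import Defs.
From mathcomp Require Import all_boot zify.

(** Only edges matter: if every edge of G' joins two vertices at flip-distance
at most 5 with respect to T, then the triangle inequality inside each
T-definable flip turns a path of length r in G' into flip-distance at most 5r.
Call a pair of vertices far when its flip-distance exceeds 5, that is, when
some T-definable flip of G puts the two vertices at distance more than 5. The
graph G' must have no far edges, so S has to be such that between two parts of
the partition defined by S all far pairs agree on adjacency in G: then
complementing exactly the pairs of parts that contain a far edge of G removes
all far edges and creates none.

Suppose that (u, v) and (u', v') are far, that u and u' are S-twins and v and v'
are S-twins, and that u'v' is an edge of G while uv is not. Let A and B be the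
T-parts of u and v. A flip H1 separating u' from v' must complement (A, B), and
a flip H2 separating u from v must not. If S contains a neighbour of u in B, then
u and u' have it as a common neighbour in H2; if S contains a non-neighbour of u
in B, then u and u' have it as a common neighbour in H1; likewise for v, v' and
A. If u is close to u' and v is close to v' in the same H1 or H2, then the edge
uv of H1, or u'v' of H2, closes a path of length 5 between a pair that this flip
was supposed to separate. So S only has to exclude the mixed situations: it must
meet every T-part, and for every ordered pair (A, B) of T-parts either each
vertex of A has a neighbour in B and S, or each vertex of B has a non-neighbour
in A and S ([far_pairs_homogeneous]).

That such sets of size bounded in terms of d exist for each pair (A, B) is the
dichotomy [dominating_or_antidominating], a combination of a minimax argument
with epsilon-nets. If no small set of A meets all non-neighbourhoods, then by
the epsilon-net theorem ([hitting_seq]) every multiset over A has b in B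
adjacent to at least three quarters of it; the multiplicative weights method
([multiplicative_weights]) turns this into a multiset over B a quarter of which,
at least, is adjacent to any given a in A; and a second epsilon-net dominates A.
The epsilon-net theorem comes from double sampling ([hitting_ffun]), which rests
on the Sauer-Shelah bound on traces ([card_traces]). The same bound shows that T
has at most k^(3d) parts, so |S| is at most k^(15d). When d = 0 the graph has no
edges and nothing has to be flipped. *)

Set Implicit Arguments.
Unset Strict Implicit.
Unset Printing Implicit Defensive.

(** * Shattering and traces *)

Definition family_shatters (T : finType) (F : {set {set T}}) (A : {set T}) :=
  [forall B : {set T}, (B \subset A) ==> [exists U in F, U :&: A == B]].

Lemma family_shattersP (T : finType) (F : {set {set T}}) (A : {set T}) :
  reflect (forall B : {set T}, B \subset A -> exists2 U, U \in F & U :&: A = B)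
          (family_shatters F A).
Proof.
apply: (iffP forallP) => [sh B BA|sh B].
  by have /implyP/(_ BA)/exists_inP[U UF /eqP UB] := sh B; exists U.
by apply/implyP=> /sh[U UF UB]; apply/exists_inP; exists U => //; apply/eqP.
Qed.

(** Pajor's form of the Sauer-Shelah lemma. Split F by an element x that
distinguishes two members. A set shattered by one of the halves does not contain
x, and if it is shattered by both halves then F also shatters its extension by
x, so the numbers of sets shattered by the halves add up to at most that for
F. *)
Lemma card_family_shattered (T : finType) (F : {set {set T}}) :
  #|F| <= #|[set A | family_shatters F A]|.
Proof.
have [n] := ubnP #|F|; elim: n F => // n IH F ltFn.
have [/card_gt1P[X [Y [XF YF neqXY]]]|leF1] := ltnP 1 #|F|; last first.
  have [->|[U UF]] := set_0Vmem F; first by rewrite cards0.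
  apply: leq_trans leF1 _; apply/card_gt0P; exists set0.
  rewrite inE; apply/family_shattersP=> B; rewrite subset0 => /eqP->.
  by exists U; rewrite ?setI0.
have [x xXY] : exists x, (x \in X) != (x \in Y).
  apply/existsP; apply: contraNT neqXY; rewrite negb_exists => /forallP eqXY.
  by apply/eqP/setP=> x; apply/eqP; have := eqXY x; rewrite negbK.
pose F1 := [set U in F | x \in U]; pose F0 := [set U in F | x \notin U].
have cardF : #|F| = #|F1| + #|F0|.
  rewrite -(cardsID [set U : {set T} | x \in U] F).
  congr (_ + _); apply: eq_card => U.
    by rewrite !inE.
  by rewrite !inE andbC.
have [F1gt0 F0gt0] : 0 < #|F1| /\ 0 < #|F0|.
  by case xX: (x \in X) xXY; case xY: (x \in Y) => // _; split;
     apply/card_gt0P; [exists X|exists Y|exists Y|exists X];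
     rewrite inE ?xX ?xY ?XF ?YF.
pose Sh (E : {set {set T}}) := [set A | family_shatters E A].
have Sh1x A : A \in Sh F1 -> x \notin A.
  rewrite inE => /family_shattersP/(_ set0 (sub0set _))[U].
  rewrite inE => /andP[_ xU] /setP/(_ x); rewrite !inE xU /= => ->; by [].
have Sh0x A : A \in Sh F0 -> x \notin A.
  rewrite inE => /family_shattersP/(_ A (subxx _))[U].
  by rewrite inE => /andP[_ xU] /setP/(_ x); rewrite !inE (negPf xU) /= => <-.
have inj : {in Sh F1 :&: Sh F0 &, injective (setU [set x])}.
  move=> A B /setIP[/Sh1x xA _] /setIP[/Sh1x xB _] eqAB.
  by rewrite -(setU1K xA) -(setU1K xB) eqAB.
have subU : Sh F1 :|: Sh F0 \subset Sh F.
  apply/subsetP=> A; rewrite !inE => shA; apply/family_shattersP=> B BA.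
  by case/orP: shA => /family_shattersP/(_ B BA)[U]; rewrite inE => /andP[UF _];
     exists U.
have subI : [set x |: A | A in Sh F1 :&: Sh F0] \subset Sh F.
  apply/subsetP=> _ /imsetP[A AI ->]; case/setIP: AI => A1 A0.
  have xA := Sh1x A A1; move: A1 A0; rewrite !inE.
  move=> /family_shattersP A1 /family_shattersP A0; apply/family_shattersP=> B BA.
  have BxA : B :\ x \subset A by rewrite subDset.
  have [xB|xB] := boolP (x \in B).
    have [U] := A1 _ BxA; rewrite inE => /andP[UF xU] UA; exists U => //.
    by rewrite setIUr UA (setIidPr _) ?sub1set // setD1K.
  have [U] := A0 _ BxA; rewrite inE => /andP[UF xU] UA; exists U => //.
  rewrite setIUr UA; apply/setP=> y; rewrite !inE.
  by have [->|_] := eqVneq y x; rewrite ?andbF // (negPf xU) (negPf xB).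
have dis : [disjoint Sh F1 :|: Sh F0 & [set x |: A | A in Sh F1 :&: Sh F0]].
  rewrite disjoint_sym disjoint_subset; apply/subsetP=> _ /imsetP[A _ ->].
  rewrite !inE negb_or; apply/andP; split; apply/negP=> h.
    by have /negP := Sh1x (x |: A) ltac:(by rewrite inE); rewrite setU11.
  by have /negP := Sh0x (x |: A) ltac:(by rewrite inE); rewrite setU11.
have sub : (Sh F1 :|: Sh F0) :|: [set x |: A | A in Sh F1 :&: Sh F0] \subset Sh F.
  by rewrite subUset subU.
apply: leq_trans (subset_leq_card sub).
move: dis; rewrite -leq_card_setU => /eqP->.
rewrite card_in_imset // cardsUI cardF.
by apply: leq_add; apply: IH; lia.
Qed.

Lemma leq_expl m n d : m <= n -> m ^ d <= n ^ d.
Proof. by case: d => // d mn; rewrite leq_exp2r. Qed.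

Lemma sum_bin_leq_exp n d : \sum_(i < d.+1) 'C(n, i) <= n.+1 ^ d.
Proof.
elim: d => [|d IH]; first by rewrite big_ord_recr big_ord0 /= bin0.
rewrite big_ord_recr /= expnS mulSn; apply: leq_add IH _.
have binX : 'C(n, d.+1) <= n ^ d.+1.
  rewrite (leq_trans (leq_pmulr _ (fact_gt0 d.+1))) // bin_ffact.
  elim: d.+1 => // i IHi; rewrite ffactnSr expnSr.
  by apply: leq_mul => //; apply: leq_subr.
by apply: leq_trans binX _; rewrite expnS leq_mul // leq_expl.
Qed.

Lemma leq_card_bigcup (I T : finType) (P : pred I) (A : I -> {set T}) :
  #|\bigcup_(i | P i) A i| <= \sum_(i | P i) #|A i|.
Proof.
elim/big_rec2: _ => [|i n B _ leB]; first by rewrite cards0.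
by rewrite (leq_trans (leq_card_setU _ _).1) ?leq_add2l.
Qed.

(** A set shattered by the traces on P is a subset of P shattered by r, hence
has at most d elements. *)
Lemma card_traces (V : finType) (r : rel V) (d : nat) (P : {set V}) :
  vcdim r <= d -> #|[set nbhd r u :&: P | u : V]| <= #|P|.+1 ^ d.
Proof.
move=> vcd; apply: leq_trans (card_family_shattered _) _.
apply: leq_trans (sum_bin_leq_exp _ _).
pose D i := [set A : {set V} | A \subset P & #|A| == i].
have sub : [set A | family_shatters [set nbhd r u :&: P | u : V] A]
    \subset \bigcup_(i < d.+1) D i.
  apply/subsetP=> A; rewrite inE => /family_shattersP sh.
  have AP : A \subset P.
    have [_ /imsetP[u _ ->] <-] := sh A (subxx _).
    by rewrite -setIA setICA subsetIl.
  have Ad : #|A| < d.+1.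
    rewrite ltnS; apply: leq_trans vcd.
    apply: (@leq_bigmax_cond _ (shatters r) (fun X => #|X|) A).
    apply/forallP=> B; apply/implyP=> /sh[_ /imsetP[u _ ->]] <-.
    by apply/existsP; exists u; rewrite -setIA (setIidPr AP).
  by apply/bigcupP; exists (Ordinal Ad) => //; rewrite inE AP /=.
apply: leq_trans (subset_leq_card sub) _.
apply: leq_trans (leq_card_bigcup _ _) _.
by apply: leq_sum => i _; rewrite cards_draws.
Qed.

(** * Epsilon-nets by double sampling *)

Lemma card_ffun_at (I W : finType) (K : {set W}) (i : I) :
  #|W| * #|[set y : {ffun I -> W} | y i \in K]| = #|K| * #|{ffun I -> W}|.
Proof.
pose F j w : nat := (j == i) ==> (w \in K).
have <- : \prod_j \sum_w F j w = #|[set y : {ffun I -> W} | y i \in K]|.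
  rewrite bigA_distr_bigA -sum1_card [RHS]big_mkcond /=; apply: eq_bigr => y _.
  rewrite (bigD1 i) //= {1}/F eqxx inE big1 ?muln1 => [|j /negPf ji].
    by case: (y i \in K).
  by rewrite /F ji.
rewrite card_ffun -prod_nat_const (bigD1 i) //= [in RHS](bigD1 i) //=.
have -> : \sum_w F i w = #|K|.
  rewrite -sum1_card [RHS]big_mkcond; apply: eq_bigr => w _.
  by rewrite /F eqxx; case: (w \in K).
rewrite mulnCA; congr (_ * (_ * _)); apply: eq_bigr => j /negPf ji.
by rewrite (eq_bigr (fun=> 1)) ?sum1_card // => w _; rewrite /F ji.
Qed.

(** A Markov argument. On average a random y hits K in at least a quarter of the
8t coordinates, that is, 2t times; those y that hit it fewer than t times
contribute less than t each, so at least one y in eight must make up the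
rest. *)
Lemma card_ffun_hits (I W : finType) (K : {set W}) t :
  #|I| = 8 * t -> 0 < t -> 0 < #|W| -> #|W| <= 4 * #|K| ->
  #|{ffun I -> W}| <=
    8 * #|[set y : {ffun I -> W} | t <= #|[set i | y i \in K]|]|.
Proof.
move=> cI t0 W0 WK; set g := (X in 8 * X); set N := #|{ffun I -> W}|.
have lo : 2 * t * N <= \sum_(y : {ffun I -> W}) #|[set i | y i \in K]|.
  have -> : \sum_(y : {ffun I -> W}) #|[set i | y i \in K]|
          = \sum_i #|[set y : {ffun I -> W} | y i \in K]|.
    transitivity (\sum_(y : {ffun I -> W}) \sum_(i : I) (y i \in K)).
      apply: eq_bigr => y _; rewrite -sum1_card big_mkcond; apply: eq_bigr => i _.
      by rewrite inE; case: ifP.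
    rewrite exchange_big; apply: eq_bigr => i _.
    rewrite -[RHS]sum1_card [RHS]big_mkcond; apply: eq_bigr => y _.
    by rewrite inE; case: ifP.
  have each i : N <= 4 * #|[set y : {ffun I -> W} | y i \in K]|.
    rewrite -(leq_pmul2l W0) mulnCA card_ffun_at mulnA.
    by rewrite leq_mul2r WK orbT.
  have : \sum_(i : I) N <= \sum_i 4 * #|[set y : {ffun I -> W} | y i \in K]|.
    by apply: leq_sum => i _.
  rewrite sum_nat_const -big_distrr /= cI; nia.
have hi : \sum_(y : {ffun I -> W}) #|[set i | y i \in K]| <= 8 * t * g + t * N.
  have -> : 8 * t * g + t * N = \sum_(y : {ffun I -> W})
      ((t <= #|[set i | y i \in K]|) * (8 * t) + t).
    rewrite big_split /= sum_nat_const -big_distrl /= [N * _]mulnC mulnC.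
    congr (_ * _ + _); rewrite /g -sum1_card big_mkcond; apply: eq_bigr => y _.
    by rewrite inE; case: ifP.
  apply: leq_sum => y _; have := max_card [set i | y i \in K]; rewrite cI.
  by case: leqP => /=; lia.
nia.
Qed.

Definition swap_on (I : finType) (W : Type) (s : {set I})
    (p : {ffun I -> W} * {ffun I -> W}) :=
  ([ffun i => if i \in s then p.2 i else p.1 i],
   [ffun i => if i \in s then p.1 i else p.2 i]).

Lemma swap_onK (I : finType) (W : Type) (s : {set I}) :
  involutive (@swap_on I W s).
Proof.
by case=> z y; congr pair; apply/ffunP=> i; rewrite !ffunE; case: (i \in s).
Qed.

(** If s is such that after swapping the first sample misses U while the second
one hits it at least t times, then at every coordinate where exactly one of z
and y lies in U the set s is forced; there are at least t such coordinates. *)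
Lemma card_swaps_missed (I V : finType) (U : {set V}) (z y : {ffun I -> V}) t :
  #|I| = 8 * t ->
  #|[set s : {set I} | [forall i, (swap_on s (z, y)).1 i \notin U] &
       t <= #|[set i | (swap_on s (z, y)).2 i \in U]|]| <= 2 ^ (7 * t).
Proof.
move=> cI; set E := [set s | _ & _].
pose J := [set i | (z i \in U) != (y i \in U)].
have [->|[s0]] := set_0Vmem E; first by rewrite cards0.
rewrite inE => /andP[/forallP miss0 hit0].
have tJ : t <= #|J|.
  apply: leq_trans hit0 (subset_leq_card _); apply/subsetP=> i.
  rewrite !inE ffunE /=; have := miss0 i; rewrite ffunE /=.
  by case: ifP => _ /negPf-> ->.
have detJ s i : s \in E -> i \in J -> (i \in s) = (z i \in U).
  rewrite !inE => /andP[/forallP/(_ i) + _]; rewrite ffunE /=.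
  by case: ifP => _ /negPf->; case: (_ \in U).
have inj : {in E &, injective (fun s : {set I} => s :\: J)}.
  move=> s s' sE sE' /= eqD; apply/setP=> i; have [iJ|iJ] := boolP (i \in J).
    by rewrite (detJ s) ?(detJ s').
  by have /setP/(_ i) := eqD; rewrite !in_setD iJ.
rewrite -(card_in_imset inj).
have sub : [set s :\: J | s in E] \subset powerset (~: J).
  apply/subsetP=> _ /imsetP[s _ ->]; rewrite inE.
  by apply/subsetP=> i; rewrite !inE => /andP[].
apply: leq_trans (subset_leq_card sub) _; rewrite card_powerset leq_exp2l //.
by have := cardsC J; lia.
Qed.

(** Double sampling for epsilon-nets with epsilon = 1/4. If every sample z is
missed by some c(z) in Q, then for at least one pair of samples (z, y) in eight
the vertex c(z) misses z but hits y at least t times. Swapping coordinates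
preserves the set of pairs of samples, so for some pair (z, y) at least one in
eight of the swaps has this property. A swap can be witnessed only through the
trace of r (c z) on the at most 16t sampled points; there are at most
(16t + 1)^d traces, and each serves at most 2^(7t) of the 2^(8t) swaps. *)
Lemma hitting_ffun (V W : finType) (r : rel V) (phi : W -> V) (Q : {set V})
    (I : finType) d t :
  vcdim r <= d -> #|I| = 8 * t -> 8 * (16 * t).+1 ^ d < 2 ^ t -> 0 < #|W| ->
  (forall b, b \in Q -> #|W| <= 4 * #|[set w | r b (phi w)]|) ->
  exists z : {ffun I -> W}, forall b, b \in Q -> exists i, r b (phi (z i)).
Proof.
move=> vcd cI tbig W0 heavy.
have t0 : 0 < t by case: t tbig {cI} => //; rewrite muln0 exp1n.
suff /existsP[z /forall_inP hz] :
    [exists z : {ffun I -> W}, [forall b in Q, [exists i, r b (phi (z i))]]].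
  by exists z => b /hz/existsP.
apply: contraT; rewrite negb_exists => /forallP miss.
have /fin_all_exists2[c cQ cmiss] (z : {ffun I -> W}) :
    exists2 b, b \in Q & forall i, ~~ r b (phi (z i)).
  have := miss z; rewrite negb_forall => /existsP[b].
  by rewrite negb_imply negb_exists => /andP[bQ /forallP]; exists b.
pose good (p : {ffun I -> W} * {ffun I -> W}) : bool :=
  t <= #|[set i | r (c p.1) (phi (p.2 i))]|.
set M := #|{ffun I -> W}|.
have M0 : 0 < M by rewrite /M card_ffun expn_gt0 W0.
have manygood : M * M <= 8 * \sum_p good p.
  have -> : \sum_p good p = \sum_z \sum_y good (z, y).
    by rewrite pair_bigA; apply: eq_bigr => -[].
  rewrite big_distrr /= -{1}/M -sum_nat_const; apply: leq_sum => z _.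
  have := @card_ffun_hits I W [set w | r (c z) (phi w)] t cI t0 W0
    (heavy _ (cQ z)).
  move/leq_trans; apply; rewrite leq_mul2l /=.
  rewrite -sum1_card big_mkcond; apply: leq_sum => y _; rewrite inE.
  rewrite /good /=; set A := [set i | _]; set B := [set i | _].
  have -> : A = B by apply/setP=> i; rewrite !inE.
  by case: ifP.
have [p pgood] : exists p,
    2 ^ (8 * t) <= 8 * #|[set s : {set I} | good (swap_on s p)]|.
  apply/existsP; apply: contraT; rewrite negb_exists => /forallP few.
  have : \sum_p (8 * #|[set s : {set I} | good (swap_on s p)]|).+1
      <= \sum_(p : {ffun I -> W} * {ffun I -> W}) 2 ^ (8 * t).
    by apply: leq_sum => p _; rewrite ltnNge few.
  have -> : \sum_p (8 * #|[set s : {set I} | good (swap_on s p)]|).+1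
      = 8 * (2 ^ (8 * t) * \sum_p good p) + M * M.
    rewrite (eq_bigr (fun p => 8 * \sum_(s : {set I}) good (swap_on s p) + 1)).
      rewrite big_split /= sum_nat_const card_prod muln1 -big_distrr.
      rewrite exchange_big /=.
      congr (_ * _ + _); rewrite -cI -cardsT -card_powerset -sum_nat_const.
      rewrite powersetT; apply: eq_big => [s|s _]; first by rewrite inE.
      by rewrite [RHS](reindex_inj (inv_inj (@swap_onK I W s))).
    move=> p _; rewrite addn1 -sum1_card big_mkcond; congr (8 * _).+1.
    by apply: eq_bigr => s _; rewrite inE; case: ifP.
  rewrite sum_nat_const card_prod -/M.
  by have := leq_mul (leqnn (2 ^ (8 * t))) manygood; nia.
case: p pgood => z y pgood.
pose P := [set phi (z i) | i : I] :|: [set phi (y i) | i : I].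
pose pts := ([ffun i => phi (z i)], [ffun i => phi (y i)]).
pose E (U : {set V}) := [set s : {set I} |
  [forall i, (swap_on s pts).1 i \notin U] &
  t <= #|[set i | (swap_on s pts).2 i \in U]|].
have sub : [set s : {set I} | good (swap_on s (z, y))]
    \subset \bigcup_(U in [set nbhd r u :&: P | u : V]) E U.
  apply/subsetP=> s; rewrite inE => gs; set p := swap_on s (z, y) in gs.
  apply/bigcupP; exists (nbhd r (c p.1) :&: P); first exact: imset_f.
  have in2 i : phi (p.2 i) \in P.
    by rewrite /p /swap_on /= ffunE inE; case: ifP => _; rewrite imset_f ?orbT.
  have e1 i : (swap_on s pts).1 i = phi (p.1 i).
    by rewrite /p /swap_on /= !ffunE; case: ifP.
  have e2 i : (swap_on s pts).2 i = phi (p.2 i).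
    by rewrite /p /swap_on /= !ffunE; case: ifP.
  rewrite inE; apply/andP; split.
    by apply/forallP=> i; rewrite e1 !inE negb_and cmiss.
  apply: leq_trans gs (subset_leq_card _); apply/subsetP=> i.
  by rewrite !inE e2 => rc; rewrite rc; have := in2 i; rewrite inE.
have cP : #|P| <= 16 * t.
  apply: leq_trans (leq_card_setU _ _).1 _.
  rewrite (_ : 16 * t = #|I| + #|I|) ?leq_add ?leq_imset_card //.
  by rewrite cI; lia.
have few : #|[set s : {set I} | good (swap_on s (z, y))]|
    <= (16 * t).+1 ^ d * 2 ^ (7 * t).
  apply: leq_trans (subset_leq_card sub) _.
  apply: leq_trans (leq_card_bigcup _ _) _.
  set Tr := [set _ | u : V].
  apply: leq_trans (_ : \sum_(U in Tr) 2 ^ (7 * t) <= _).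
    by apply: leq_sum => U _; apply: card_swaps_missed.
  rewrite sum_nat_const leq_mul2r (leq_trans (card_traces P vcd)) ?orbT //.
  exact: leq_expl.
move: pgood few tbig; rewrite (_ : 8 * t = t + 7 * t) ?expnD; last by lia.
have := expn_gt0 2 (7 * t); rewrite /=; nia.
Qed.

(** The sequence s stands for the distribution that weights each vertex by its
multiplicity, the form in which [multiplicative_weights] produces weights. *)
Lemma hitting_seq (V : finType) (r : rel V) (Q : {set V}) (s : seq V) d t :
  vcdim r <= d -> 8 * (16 * t).+1 ^ d < 2 ^ t -> 0 < size s ->
  (forall b, b \in Q -> size s <= 4 * count (r b) s) ->
  exists D : {set V}, [/\ #|D| <= 8 * t, {subset D <= s} &
    forall b, b \in Q -> exists2 a, a \in D & r b a].
Proof.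
move=> vcd tbig s0 heavy.
have cardW b : #|[set w | r b (tnth (in_tuple s) w)]| = count (r b) s.
  rewrite -sum1_card -sum1_count [RHS]big_tnth.
  by apply: eq_bigl => w; rewrite inE.
have [||z hz] := @hitting_ffun V _ r (tnth (in_tuple s)) Q _ d t vcd
  (card_ord (8 * t)) tbig; first by rewrite card_ord.
  by move=> b bQ; rewrite cardW card_ord heavy.
exists [set tnth (in_tuple s) (z i) | i : 'I_(8 * t)]; split.
- by apply: leq_trans (leq_imset_card _ _) _; rewrite card_ord.
- by move=> _ /imsetP[i _ ->]; apply: mem_tnth.
- by move=> b /hz[i ri]; exists (tnth (in_tuple s) (z i)) => //; apply: imset_f.
Qed.

(** * Minimax and the domination dichotomy *)

(** A constructive minimax argument. Start from one copy of each a in A; in each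
round take b adjacent to most of the current sequence s and add a second copy of
each entry of s that b misses. The length of s grows by a factor of at most 5/4
per round, while the multiplicity of a doubles with every b that misses it, so
after sufficiently many rounds no a can have been missed by more than three
quarters of the b's. *)
Lemma multiplicative_weights (V : finType) (r : rel V) (A B : {set V}) :
  (forall s, 0 < size s -> {subset s <= A} ->
     exists2 b, b \in B & 4 * count (fun a => ~~ r a b) s <= size s) ->
  A != set0 ->
  exists t, [/\ 0 < size t, {subset t <= B} &
    forall a, a \in A -> size t <= 4 * count (r a) t].
Proof.
move=> respond A0.
have run n : exists s t, [/\ size t = n /\ {subset t <= B},
    0 < size s /\ {subset s <= A}, size s * 4 ^ n <= #|A| * 5 ^ n &
    forall a, a \in A -> 2 ^ count (fun b => ~~ r a b) t <= count_mem a s].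
  elim: n => [|n [s [t [[szt tB] [s0 sA] szs wt]]]].
    exists (enum A), [::]; split=> //; rewrite -?cardE ?card_gt0 //.
    - by split=> // a; rewrite mem_enum.
    - by move=> a aA; rewrite expn0 -has_count has_pred1 mem_enum.
  have [b bB light] := respond s s0 sA.
  exists (s ++ [seq a <- s | ~~ r a b]), (b :: t); split.
  - by rewrite /= szt; split=> // x; rewrite inE => /predU1P[->|/tB].
  - rewrite size_cat ltn_addr //; split=> // a.
    by rewrite mem_cat mem_filter => /orP[/sA //|/andP[_ /sA]].
  - rewrite size_cat size_filter !expnS [X in _ <= X]mulnCA [X in X <= _]mulnA.
    apply: leq_trans (leq_mul (leqnn 5) szs); rewrite mulnA leq_mul2r.
    apply/orP; right.
    by rewrite mulnDl mulnC [_ * 4]mulnC [5 * _]mulSn addnC leq_add2r.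
  - move=> a aA /=; rewrite count_cat count_filter expnD.
    have := wt a aA; have [rab|rab] /= := boolP (r a b).
      by rewrite mul1n => /leq_trans; apply; apply: leq_addr.
    rewrite (@eq_count _ (predI (pred1 a) _) (pred1 a)) => [w|x /=].
      by rewrite expn1 mul2n -addnn leq_add.
    by have [->|//] := eqVneq x a; rewrite rab.
(* After 4n rounds, a vertex missed at least 3n times would force
   8^n * 256^n <= #|A| * 625^n, hence 2^n <= #|A|; n = #|A| rules this out. *)
have [s [t [[szt tB] _ szs wt]]] := run (4 * #|A|).
exists t; split=> //; first by rewrite szt muln_gt0 card_gt0.
move=> a aA; rewrite leqNgt; apply/negP=> few.
have := wt a aA; have := count_size (pred1 a) s; have := count_predC (r a) t.
rewrite -[count (predC _) t]/(count (fun b => ~~ r a b) t) => tot cs w.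
have big : 2 ^ (3 * #|A|) <= size s.
  apply: leq_trans cs; apply: leq_trans w; rewrite leq_exp2l //.
  by move: (count _ t) (count _ t) tot few; rewrite szt => x y; lia.
have : 2 ^ (3 * #|A|) * 4 ^ (4 * #|A|) <= #|A| * 5 ^ (4 * #|A|).
  by apply: leq_trans szs; rewrite leq_mul2r big orbT.
rewrite !expnM -expnMn leqNgt => /negP; apply.
apply: leq_trans (_ : 2 ^ #|A| * (5 ^ 4) ^ #|A| <= _).
  by rewrite ltn_mul2r ltn_expl // !expn_gt0.
by rewrite -expnMn; apply: leq_expl.
Qed.

Lemma vcdim_compl (V : finType) (r : rel V) :
  vcdim (fun u v => ~~ r u v) <= vcdim r.
Proof.
apply/bigmax_leqP=> A /forallP sh.
apply: (@leq_bigmax_cond _ (shatters r) (fun X => #|X|) A).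
apply/forallP=> B; apply/implyP=> BA.
have /implyP/(_ (subsetDl A B))/existsP[u /eqP/setP uB] := sh (A :\: B).
apply/existsP; exists u; apply/eqP/setP=> x; have := uB x; rewrite !inE.
have [xB|xB] := boolP (x \in B).
  by rewrite (subsetP BA) // !andbT => /negbFE.
by case: (r u x); case: (x \in A).
Qed.

(** If no small subset of A meets the non-neighbourhoods of all b in B, then
[hitting_seq], applied to non-adjacency, provides the hypothesis of
[multiplicative_weights]; the resulting sequence over B is hit by every
neighbourhood with density at least 1/4, so it contains a small dominating
set. *)
Lemma dominating_or_antidominating (V : finType) (e : rel V) d t :
  symmetric e -> vcdim e <= d -> 8 * (16 * t).+1 ^ d < 2 ^ t ->
  forall A B : {set V}, exists D : {set V}, #|D| <= 8 * t /\
    ((forall a, a \in A -> exists2 b, b \in B :&: D & e a b) \/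
     (forall b, b \in B -> exists2 a, a \in A :&: D & ~~ e b a)).
Proof.
move=> esym vcd tbig A B; have [->|A0] := eqVneq A set0.
  by exists set0; rewrite cards0; split=> //; left=> a; rewrite inE.
pose anti (D : {set V}) := (#|D| <= 8 * t) &&
  [forall b in B, [exists a in A :&: D, ~~ e b a]].
have [/existsP[D /andP[cD /forall_inP aD]]|none] := boolP [exists D, anti D].
  by exists D; split=> //; right=> b /aD/exists_inP[a]; exists a.
have [s s0 sA|s [s0 sB heavy]] := @multiplicative_weights V e A B _ A0.
  apply/exists_inP; apply: contraNT none; rewrite negb_exists => /forallP heavy.
  have [|D [cD Ds hD]] := @hitting_seq V (fun u v => ~~ e u v) B s d t
      (leq_trans (vcdim_compl _) vcd) tbig s0.
    move=> b bB; have := heavy b; rewrite bB /= -ltnNge => /ltnW.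
    by rewrite (eq_count (a2 := fun a => ~~ e b a)) // => a; rewrite esym.
  apply/existsP; exists D; rewrite /anti cD; apply/forall_inP=> b /hD[a aD ba].
  by apply/exists_inP; exists a => //; rewrite inE aD sA ?Ds.
have [D [cD Ds hD]] := hitting_seq vcd tbig s0 heavy.
exists D; split=> //; left=> a /hD[b bD ab].
by exists b => //; rewrite inE bD sB ?Ds.
Qed.

(** * Distances, definable partitions and twins *)

Section Distance.
Variables (V : finType) (h : rel V).

Lemma dist_le_refl u n : lee (dist h u u) (Some n).
Proof. by apply/dist_leP; exists [::]. Qed.

Lemma dist_le_edge u v : h u v -> lee (dist h u v) (Some 1).
Proof. by move=> uv; apply/dist_leP; exists [:: v]; rewrite /= uv. Qed.

Lemma dist_le_trans v u w m n :
  lee (dist h u v) (Some m) -> lee (dist h v w) (Some n) ->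
  lee (dist h u w) (Some (m + n)).
Proof.
move=> /dist_leP[p [sp pp lp]] /dist_leP[q [sq pq lq]].
apply/dist_leP; exists (p ++ q); rewrite size_cat leq_add // cat_path last_cat.
by rewrite pp lp.
Qed.

Lemma dist_le_weaken m n u v :
  m <= n -> lee (dist h u v) (Some m) -> lee (dist h u v) (Some n).
Proof.
by move=> mn; rewrite /lee; case: (dist h u v) => // k /leq_trans; apply.
Qed.

Lemma dist_le_sym n u v :
  symmetric h -> lee (dist h u v) (Some n) -> lee (dist h v u) (Some n).
Proof.
move=> hs /dist_leP[p [sp pp <-]]; apply/dist_leP; exists (rev (belast u p)).
rewrite size_rev size_belast sp rev_path (eq_path (e' := h)) // pp; split=> //.
by case: p {sp pp} => //= x p; rewrite rev_cons last_rcons.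
Qed.

End Distance.

Section DefinablePartition.
Variables (V : finType) (e : rel V).
Implicit Types (S T : {set V}) (u v w : V).

Local Notation part S := (pblock (def_partition e S)).

Lemma mem_part S u : u \in part S u.
Proof.
by have /and3P[/eqP cov _ _] := def_partitionP e S; rewrite mem_pblock cov.
Qed.

Lemma part_mem S u : part S u \in def_partition e S.
Proof.
by have /and3P[/eqP cov _ _] := def_partitionP e S; rewrite pblock_mem ?cov.
Qed.

Lemma eq_part S u v : v \in part S u -> part S v = part S u.
Proof. by have /and3P[_ tI _] := def_partitionP e S => /(same_pblock tI). Qed.

Lemma part_in S u : u \in S -> part S u = [set u].
Proof.
have /and3P[_ tI _] := def_partitionP e S => uS.
by apply: (def_pblock tI); rewrite ?inE ?imset_f.
Qed.

Lemma part_notin S u : u \notin S ->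
  part S u = [set w in ~: S | nbhd e u :&: S == nbhd e w :&: S].
Proof.
have /and3P[_ tI _] := def_partitionP e S => uS.
apply: (def_pblock tI); last by rewrite !inE uS eqxx.
by rewrite inE; apply/orP; right; apply: imset_f; rewrite inE.
Qed.

Lemma part_eqP S u v : part S u = part S v ->
  u = v \/ [/\ u \notin S, v \notin S & nbhd e u :&: S = nbhd e v :&: S].
Proof.
move=> eqp; have := mem_part S v; rewrite -eqp.
have [uS|uS] := boolP (u \in S).
  by rewrite part_in // inE => /eqP->; left.
by rewrite part_notin // !inE => /andP[vS /eqP]; right.
Qed.

Lemma part_refine S T u v :
  T \subset S -> part S u = part S v -> part T u = part T v.
Proof.
move=> TS /part_eqP[->//|[uS vS eqN]]; apply/esym/eq_part.
have notT w : w \notin S -> w \notin T by apply: contra; apply/subsetP.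
rewrite part_notin ?notT // !inE notT //=.
by rewrite -(setIidPr TS) !setIA eqN.
Qed.

Lemma card_def_partition S d :
  vcdim e <= d -> #|def_partition e S| <= #|S| + #|S|.+1 ^ d.
Proof.
move=> vcd; apply: leq_trans (leq_card_setU _ _).1 _; apply: leq_add.
  exact: leq_imset_card.
apply: leq_trans (card_traces S vcd).
pose g X := [set w in ~: S | X == nbhd e w :&: S].
apply: leq_trans (leq_imset_card g _); apply/subset_leq_card/subsetP.
by move=> _ /imsetP[u _ ->]; apply/imsetP; exists (nbhd e u :&: S);
  first exact: imset_f.
Qed.

(** Distinct twins lie outside S and agree on their adjacency to w in S; as they
are also T-twins, the flip treats them alike with respect to w, which becomes a
common neighbour. *)
Lemma twins_close S T (F : {set {set {set V}}}) u u' w :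
  symmetric e -> part S u = part S u' -> T \subset S -> w \in S ->
  e u w (+) ([set part T u; part T w] \in F) ->
  lee (dist (definable_flip e T F) u u') (Some 2).
Proof.
move=> es eqp TS wS uw; have [->|[uS u'S eqN]] := part_eqP eqp.
  exact: dist_le_refl.
have neq x : x \notin S -> x != w.
  by move=> xS; apply: contraNneq xS => ->.
have eu' : e u' w = e u w.
  by have /setP/(_ w) := eqN; rewrite !inE wS !andbT.
apply/dist_leP; exists [:: w; u']; rewrite /= andbT; split=> //.
rewrite /definable_flip /flip neq // uw eq_sym neq // es eu' setUC.
by rewrite -(part_refine TS eqp).
Qed.

(** The hypotheses on S are those that exclude the mixed situations, in which u
is close to u' in one of the two flips only, and v is close to v' in the other
one only. *)
Lemma far_pairs_homogeneous S T (F1 F2 : {set {set {set V}}}) u v u' v' :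
  symmetric e -> T \subset S ->
  (forall x, exists2 w, w \in part T x & w \in S) ->
  (forall x y, (exists2 w, w \in part T y :&: S & e x w) \/
               (exists2 w, w \in part T x :&: S & ~~ e y w)) ->
  part S u = part S u' -> part S v = part S v' ->
  u != v -> ~~ e u v -> e u' v' ->
  ~~ lee (dist (definable_flip e T F2) u v) (Some 5) ->
  lee (dist (definable_flip e T F1) u' v') (Some 5).
Proof.
move=> es TS rep dom pu pv neq uv u'v' far2; apply: contraT => far1.
have [pTu pTv] := (part_refine TS pu, part_refine TS pv).
have fs F : symmetric (definable_flip e T F) by apply: flip_sym.
have neq' : u' != v'.
  by apply: contraNneq far1 => ->; apply: dist_le_refl.
(* A flip that separates a pair determines whether it complements the two parts:
   F1 does and F2 does not. *)
have nF2 : [set part T u; part T v] \notin F2.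
  apply: contra far2 => inF; apply: (@dist_le_weaken _ _ 1) => //.
  by apply: dist_le_edge; rewrite /definable_flip /flip neq (negPf uv) inF.
have inF1 : [set part T u; part T v] \in F1.
  apply: contraNT far1 => nF; apply: (@dist_le_weaken _ _ 1) => //.
  apply: dist_le_edge; rewrite /definable_flip /flip neq' u'v' -pTu -pTv.
  by rewrite (negPf nF).
have edge1 : definable_flip e T F1 u v.
  by rewrite /definable_flip /flip neq (negPf uv) inF1.
have edge2 : definable_flip e T F2 u' v'.
  by rewrite /definable_flip /flip neq' u'v' -pTu -pTv (negPf nF2).
pose cu F := lee (dist (definable_flip e T F) u u') (Some 2).
pose cv F := lee (dist (definable_flip e T F) v v') (Some 2).
have near_u w : w \in part T v -> w \in S -> if e u w then cu F2 else cu F1.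
  move=> /eq_part wv wS; case: ifP => uw; apply: (twins_close es pu TS wS).
    by rewrite uw wv (negPf nF2).
  by rewrite uw wv inF1.
have near_v w : w \in part T u -> w \in S -> if e v w then cv F2 else cv F1.
  move=> /eq_part wu wS; case: ifP => vw; apply: (twins_close es pv TS wS).
    by rewrite vw wu setUC (negPf nF2).
  by rewrite vw wu setUC inF1.
have not1 : cu F1 -> cv F1 -> False.
  move=> c1 c2; case/negP: far1; rewrite -[5]/(2 + 1 + 2).
  apply: dist_le_trans c2; apply: dist_le_trans (dist_le_edge edge1).
  exact: dist_le_sym.
have not2 : cu F2 -> cv F2 -> False.
  move=> c1 c2; case/negP: far2; rewrite -[5]/(2 + 1 + 2).
  apply: dist_le_trans (dist_le_sym (fs _) c2).
  exact: dist_le_trans c1 (dist_le_edge edge2).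
have alt_u : cu F1 \/ cu F2.
  by have [w wv wS] := rep v; have := near_u w wv wS; case: ifP; auto.
have alt_v : cv F1 \/ cv F2.
  by have [w wu wS] := rep u; have := near_v w wu wS; case: ifP; auto.
have alt_uv : cu F2 \/ cv F1.
  case: (dom u v) => -[w /setIP[wp wS]].
    by move=> xw; have := near_u w wp wS; rewrite xw; left.
  by move=> /negPf xw; have := near_v w wp wS; rewrite xw; right.
have alt_vu : cv F2 \/ cu F1.
  case: (dom v u) => -[w /setIP[wp wS]].
    by move=> xw; have := near_v w wp wS; rewrite xw; left.
  by move=> /negPf xw; have := near_u w wp wS; rewrite xw; right.
by case: alt_u alt_v alt_uv alt_vu => [|] hu [|] hv [|] h1 [|] h2;
  try (by case: not1); case: not2.
Qed.

End DefinablePartition.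

Lemma edges_close_ball_sub (V : finType) (e h : rel V) (T : {set V}) (c r : nat)
    (v : V) :
  (forall x y, h x y -> lee (flip_dist e T x y) (Some c)) ->
  ball h r v \subset flip_ball e T (c * r) v.
Proof.
move=> hc; apply/subsetP=> u; rewrite !inE => /dist_leP[p [sp pp <-]].
apply/flip_dist_leP=> F; apply: (@dist_le_weaken _ _ (c * size p)).
  by rewrite leq_mul2l sp orbT.
elim: p u pp {sp} => [|x p IH] u /=; first by rewrite dist_le_refl.
move=> /andP[ux xp]; rewrite mulnS; apply: dist_le_trans (IH x xp).
by have /flip_dist_leP := hc _ _ ux.
Qed.

(** * The separating set *)

(** The value t = 8 d (d + 1) meets the size condition of [hitting_ffun]. *)
Lemma sample_size_large d : 0 < d ->
  8 * (16 * (8 * (d * d.+1))).+1 ^ d < 2 ^ (8 * (d * d.+1)).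
Proof.
move=> d0; have dd : d * d.+1 < 4 ^ d.
  by rewrite (_ : 4 = 2 * 2) // expnMn; have := ltn_expl d (isT : 1 < 2); nia.
apply: leq_ltn_trans (_ : (8 * (16 * (8 * (d * d.+1))).+1) ^ d < _).
  rewrite expnMn leq_mul2r; apply/orP; right.
  by rewrite -[X in X <= _]expn1 leq_exp2l.
rewrite (_ : 8 * (d * d.+1) = 8 * d.+1 * d); last by lia.
rewrite expnM ltn_exp2r //.
apply: leq_ltn_trans (_ : 2 ^ 10 * 4 ^ d < _).
  rewrite (_ : 8 * d.+1 * d = 8 * (d * d.+1)); last by lia.
  by rewrite -[2 ^ 10]/1024; lia.
by rewrite -[4]/(2 ^ 2) -expnM -expnD ltn_exp2l //; lia.
Qed.

Lemma set_size_bound k d p q : 1 < k -> 0 < d -> p <= k + k.+1 ^ d -> q <= k ->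
  q + p * p * (8 * (8 * (d * d.+1))).+1 <= k ^ (15 * d).
Proof.
move=> k1 d0 pk qk; have k0 : 0 < k by lia.
have pb : p <= k ^ (3 * d).
  apply: leq_trans (_ : 2 * k ^ (2 * d) <= _).
    have kd : k <= k ^ (2 * d) by rewrite -[X in X <= _]expn1 leq_exp2l //; lia.
    have : k.+1 ^ d <= k ^ (2 * d) by rewrite expnM leq_exp2r //; nia.
    by move: kd; lia.
  apply: leq_trans (leq_mul k1 (leqnn _)) _.
  by rewrite -expnS leq_exp2l //; lia.
have sb : (8 * (8 * (d * d.+1))).+1 <= k ^ (8 * d).
  apply: leq_trans (_ : 2 ^ 6 * 4 ^ d <= _).
    rewrite -[2 ^ 6]/64 -[4]/(2 * 2) expnMn.
    by have := ltn_expl d (isT : 1 < 2); nia.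
  rewrite -[4]/(2 ^ 2) -expnM -expnD.
  apply: leq_trans (_ : 2 ^ (8 * d) <= _); first by rewrite leq_exp2l //; lia.
  by rewrite leq_exp2r //; lia.
apply: leq_trans (_ : 2 * k ^ (14 * d) <= _).
  have : p * p * (8 * (8 * (d * d.+1))).+1 <= k ^ (14 * d).
    rewrite (_ : 14 * d = 3 * d + 3 * d + 8 * d); last by lia.
    rewrite (expnD _ (_ + _)) (expnD _ (3 * d)); apply: leq_mul sb.
    exact: leq_mul.
  have : k <= k ^ (14 * d) by rewrite -[X in X <= _]expn1 leq_exp2l //; lia.
  lia.
apply: leq_trans (leq_mul k1 (leqnn _)) _.
by rewrite -expnS leq_exp2l //; lia.
Qed.

Lemma set2_eq (T : finType) (a b c d : T) :
  [set a; b] = [set c; d] -> (a = c /\ b = d) \/ (a = d /\ b = c).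
Proof.
move=> eqs; have /set2P ha : a \in [set c; d] by rewrite -eqs set21.
have /set2P hb : b \in [set c; d] by rewrite -eqs set22.
have /set2P hc : c \in [set a; b] by rewrite eqs set21.
have /set2P hd : d \in [set a; b] by rewrite eqs set22.
by clear eqs; intuition congruence.
Qed.

Lemma separating_set (V : finType) (e : rel V) (T : {set V}) k d :
  symmetric e -> vcdim e <= d -> #|T| <= k -> 1 < k -> 0 < d ->
  exists S : {set V}, [/\ #|S| <= k ^ (15 * d), T \subset S,
    forall x, exists2 w, w \in pblock (def_partition e T) x & w \in S &
    forall x y, (exists2 w, w \in pblock (def_partition e T) y :&: S & e x w) \/
                (exists2 w, w \in pblock (def_partition e T) x :&: S & ~~ e y w)].
Proof.
move=> es vcd cT k1 d0; set P := def_partition e T; set t := 8 * (d * d.+1).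
have /fin_all_exists[D hD] (p : {set V} * {set V}) : exists D : {set V},
    [/\ #|D| <= (8 * t).+1, p.1 != set0 -> exists2 w, w \in p.1 & w \in D &
     (forall a, a \in p.1 -> exists2 b, b \in p.2 :&: D & e a b) \/
     (forall b, b \in p.2 -> exists2 a, a \in p.1 :&: D & ~~ e b a)].
  have [D [cD domD]] :=
    dominating_or_antidominating es vcd (sample_size_large d0) p.1 p.2.
  (* [dominating_or_antidominating] does not ensure that D meets p.1. *)
  have [->|[w wp]] := set_0Vmem p.1.
    by exists set0; rewrite cards0 eqxx; split=> //; left=> a; rewrite inE.
  exists (w |: D); split.
  - by rewrite cardsU1 -add1n leq_add //; case: (w \notin D).
  - by move=> _; exists w; rewrite // setU11.
  - by case: domD => h; [left=> a /h|right=> b /h] => -[x /setIP[xp xD] ex];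
       exists x; rewrite // !inE xp xD orbT.
exists (T :|: \bigcup_(p in setX P P) D p).
have subD A B : A \in P -> B \in P ->
    D (A, B) \subset T :|: \bigcup_(p in setX P P) D p.
  move=> AP BP; apply: subset_trans (subsetUr _ _).
  by apply: (bigcup_sup (A, B)); rewrite inE AP BP.
split.
- apply: leq_trans (leq_card_setU _ _).1 _.
  apply: leq_trans (set_size_bound k1 d0 (p := #|P|) _ cT).
    rewrite leq_add2l; apply: leq_trans (leq_card_bigcup _ _) _.
    rewrite -cardsX -sum_nat_const; apply: leq_sum => p _.
    by have [] := hD p.
  apply: leq_trans (card_def_partition _ vcd) _.
  by rewrite leq_add // leq_expl.
- exact: subsetUl.
- move=> x; have [_ + _] := hD (pblock P x, pblock P x).
  case=> [|w wx wD]; first by apply/set0Pn; exists x; apply: mem_part.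
  exists w => //.
  exact: subsetP (subD _ _ (part_mem _ _ _) (part_mem _ _ _)) _ wD.
- move=> x y; have sub := subD _ _ (part_mem e T x) (part_mem e T y).
  have [_ _ [h|h]] := hD (pblock P x, pblock P y).
    have [w /setIP[wy wD] xw] := h x (mem_part e T x).
    by left; exists w; rewrite // inE wy (subsetP sub).
  have [w /setIP[wx wD] yw] := h y (mem_part e T y).
  by right; exists w; rewrite // inE wx (subsetP sub).
Qed.

Lemma vcdim0_edgeless (V : finType) (e : rel V) u v :
  irreflexive e -> vcdim e <= 0 -> e u v = false.
Proof.
move=> ei vcd; apply/negP=> uv; suff : 1 <= 0 by [].
apply: leq_trans vcd; rewrite -(cards1 v).
apply: (@leq_bigmax_cond _ (shatters e) (fun X => #|X|) [set v]).
apply/forallP=> B; apply/implyP; rewrite subset1 => /orP[]/eqP->; apply/existsP.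
  by exists u; apply/eqP/setIidPr; rewrite sub1set inE.
exists v; apply/eqP/setP=> x; rewrite !inE.
by have [->|_] := eqVneq x v; rewrite ?ei ?andbF.
Qed.

Lemma flip_dist_gtP (V : finType) (e : rel V) (T : {set V}) u v r :
  ~~ lee (flip_dist e T u v) (Some r) ->
  exists F, ~~ lee (dist (definable_flip e T F) u v) (Some r).
Proof.
move=> far; apply/existsP; apply: contraNT far.
rewrite negb_exists => /forallP near.
by apply/flip_dist_leP=> F; have := near F; rewrite negbK.
Qed.

Theorem lemma5 :
  exists C : nat,
    forall (V : finType) (e : rel V) (T : {set V}) (k d : nat),
      symmetric e -> irreflexive e ->
      vcdim e <= d -> #|T| <= k -> 2 <= k ->
      exists (S : {set V}) (F : {set {set {set V}}}),
        #|S| <= k ^ (C * d ^ 2) /\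
        forall (v : V) (r : nat),
          ball (definable_flip e S F) r v \subset flip_ball e T (30 * r) v.
Proof.
exists 15 => V e T k d es ei vcd cT k2.
have [d0|d0] := posnP d.
  exists set0, set0; rewrite cards0; split=> // v r.
  apply: edges_close_ball_sub => x y; rewrite /definable_flip /flip inE.
  have vcd0 : vcdim e <= 0 by rewrite -d0.
  by rewrite (vcdim0_edgeless _ _ ei vcd0) andbF.
have [S [cS TS rep dom]] := separating_set es vcd cT k2 d0.
pose P := pblock (def_partition e S).
pose far u v := ~~ lee (flip_dist e T u v) (Some 5).
exists S, [set X |
  [exists u, [exists v, [&& X == [set P u; P v], e u v & far u v]]]].
split=> [|v r].
  apply: leq_trans cS _.
  by rewrite leq_exp2l // leq_mul2l /= -mulnn leq_pmulr.
apply: edges_close_ball_sub => x y; rewrite /definable_flip /flip inE.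
case/andP=> neq; set X := [set pblock _ x; _]; move=> xy; apply: contraT => far30.
have {far30} farxy : far x y.
  apply: contra far30 => /flip_dist_leP near; apply/flip_dist_leP=> F.
  by apply: dist_le_weaken (near F).
(* A far edge of G is complemented away, so xy is a non-edge of G whose parts were
   complemented because of some far edge uv' between them. *)
have nxy : ~~ e x y.
  apply/negP=> exy; move: xy; rewrite exy /= => /negP; apply.
  by apply/existsP; exists x; apply/existsP; exists y; rewrite eqxx exy.
move: xy; rewrite (negPf nxy).
move=> /existsP[u /existsP[v' /and3P[/eqP eqX uv faruv]]].
have [F2 far2] := flip_dist_gtP farxy; have [F1 far1] := flip_dist_gtP faruv.
have homog a b (xa : P x = P a) (yb : P y = P b) (ab : e a b) :=
  far_pairs_homogeneous F1 es TS rep dom xa yb neq nxy ab far2.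
have [[px py]|[px py]] := set2_eq eqX.
  by rewrite homog in far1.
case/negP: far1; apply: dist_le_sym; first exact: flip_sym.
by apply: homog; rewrite // es.
Qed.
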